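(* Let $K$ be a field, $\Delta$ a simplicial complex on $[n]$, and $\Delta^*$ the simplicial complex whose facets are the minimal vertex covers of $\Delta$. The vertex cover algebra $A(\Delta)$ is standard graded if and only if $\Delta^*$ is a Mengerian simplicial complex.
   Context: $\mathbb{N}=\{0,1,2,\ldots\}$ and $[n]=\{1,\ldots,n\}$. A simplicial complex on $[n]$ is a collection of subsets of $[n]$ (faces) closed under taking subsets; its maximal faces are its facets, and $\mathcal{F}(\Delta)$ is the set of facets. Complexes have at least one facet and their facets are nonempty. For $k\ge 0$, a vector $\mathbf{c}=(c_1,\ldots,c_n)\in\mathbb{N}^n$ is a $k$-cover of $\Delta$ if $\sum_{i\in F}c_i\ge k$ for all $F\in\mathcal{F}(\Delta)$. Let $S=K[x_1,\ldots,x_n]$, let $t$ be a new variable, and let $A_k(\Delta)$ be the $K$-span of all monomials $x_1^{c_1}\cdots x_n^{c_n}t^k$ with $(c_1,\ldots,c_n)$ a $k$-cover of $\Delta$. The vertex cover algebra is the graded $S$-algebra $A(\Delta)=\bigoplus_{k\ge 0}A_k(\Delta)\subseteq S[t]$ (so $A_0(\Delta)=S$). It is called standard graded if it is generated over $S$ by $A_1(\Delta)$, its homogeneous elements of degree 1. A vertex cover of $\Delta$ is a subset $C\subseteq[n]$ with $C\cap F\ne\emptyset$ for all $F\in\mathcal{F}(\Delta)$; minimal means minimal under inclusion. Let $\Sigma$ be a simplicial complex on $[n]$ with facets $G_1,\ldots,G_m$, and let $M$ be its $m\times n$ facet-vertex incidence matrix (entry $(j,i)$ is $1$ if $i\in G_j$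 and $0$ otherwise). $\Sigma$ is called Mengerian if for all $\mathbf{c}\in\mathbb{N}^n$ $$\min\{\mathbf{a}\cdot\mathbf{c}:\ \mathbf{a}\in\mathbb{N}^n,\ M\mathbf{a}\ge\mathbf{1}\}=\max\{\mathbf{b}\cdot\mathbf{1}:\ \mathbf{b}\in\mathbb{N}^m,\ M^T\mathbf{b}\le\mathbf{c}\},$$ where $\mathbf{1}=(1,\ldots,1)\in\mathbb{N}^m$ and inequalities are componentwise. *)

(* Defs.v *)
From HB Require Import structures.
From mathcomp Require Import all_boot all_order all_algebra.
From mathcomp Require Import mpoly.

Set Implicit Arguments.
Unset Strict Implicit.
Unset Printing Implicit Defensive.

Import GRing.Theory.

(* The vertex set [n] = {1, ..., n} is represented by 'I_n = {0, ..., n-1}. *)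

Section Complexes.
Variable n : nat.

Definition facets_of (D : {set {set 'I_n}}) : {set {set 'I_n}} :=
  [set F | maxset (fun A => A \in D) F].

(* Not every vertex i : 'I_n is required to be a face. *)
Record scomplex := SComplex {
  faces :> {set {set 'I_n}};
  faces_closed : forall A B : {set 'I_n}, B \in faces -> A \subset B -> A \in faces;
  has_facet : facets_of faces != set0;
  facet_neq0 : forall F : {set 'I_n}, F \in facets_of faces -> F != set0
}.

Definition facets (D : scomplex) : {set {set 'I_n}} := facets_of D.

Definition vertex_cover (D : scomplex) (C : {set 'I_n}) : bool :=
  [forall F in facets D, C :&: F != set0].

Definition min_vertex_covers (D : scomplex) : {set {set 'I_n}} :=
  [set C | minset (vertex_cover D) C].

Definition dual_faces (D : scomplex) : {set {set 'I_n}} :=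
  [set A : {set 'I_n} | [exists C in min_vertex_covers D, A \subset C]].

Lemma dual_facetsE (D : scomplex) :
  facets_of (dual_faces D) = min_vertex_covers D.
Proof.
have sub C : C \in min_vertex_covers D -> C \in dual_faces D.
  by move=> hC; rewrite inE; apply/existsP; exists C; rewrite hC subxx.
apply/setP => C; rewrite [LHS]inE; apply/maxsetP/idP => [[]|hC].
  rewrite /= inE => /existsP[C' /andP[hC' sCC']] maxC.
  by rewrite -(maxC C' (sub _ hC') sCC').
split=> [|B]; first exact: sub.
rewrite /= inE => /existsP[C' /andP[hC' sBC']] sCB.
have sCC' := subset_trans sCB sBC'.
move: (hC) (hC'); rewrite !inE => /minsetp vC /minsetinf/(_ vC sCC') eCC'.
by apply/eqP; rewrite eqEsubset sCB eCC' sBC'.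
Qed.

Lemma dual_closed (D : scomplex) (A B : {set 'I_n}) :
  B \in dual_faces D -> A \subset B -> A \in dual_faces D.
Proof.
rewrite !inE => /existsP[C /andP[hC sBC]] sAB.
by apply/existsP; exists C; rewrite hC (subset_trans sAB).
Qed.

Lemma dual_has_facet (D : scomplex) : facets_of (dual_faces D) != set0.
Proof.
rewrite dual_facetsE; apply/set0Pn.
have vT : vertex_cover D setT.
  by apply/forallP => F; apply/implyP => hF; rewrite setTI (facet_neq0 hF).
by have [C hC _] := minset_exists vT; exists C; rewrite inE.
Qed.

Lemma dual_facet_neq0 (D : scomplex) (F : {set 'I_n}) :
  F \in facets_of (dual_faces D) -> F != set0.
Proof.
rewrite dual_facetsE inE => /minsetp vF; apply/eqP => F0.
have /set0Pn[G hG] := has_facet D.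
by have := implyP (forallP vF G) hG; rewrite F0 set0I eqxx.
Qed.

Definition dual_complex (D : scomplex) : scomplex :=
  SComplex (@dual_closed D) (dual_has_facet D) (@dual_facet_neq0 D).

Definition kcover (D : scomplex) (k : nat) (c : 'I_n -> nat) : Prop :=
  forall F : {set 'I_n}, F \in facets D -> k <= \sum_(i in F) c i.

End Complexes.

Section VertexCoverAlgebra.
Variables (K : fieldType) (n : nat) (D : scomplex n).
Local Open Scope ring_scope.

Local Notation S := {mpoly K[n]}.
(* The polynomial variable 'X of {poly S} plays the role of t. *)
Local Notation St := {poly {mpoly K[n]}}.

(* The K-span of the monomials x^c t^k, c a k-cover: a list of pairs (a, c)
   stands for the K-linear combination with terms a x^c t^k. *)
Definition vca_piece (k : nat) (f : St) : Prop :=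
  exists2 s : seq (K * 'X_{1..n}),
    forall ac, ac \in s -> kcover D k ac.2 &
    f = \sum_(ac <- s) (ac.1 *: ('X_[ac.2] : S)) *: 'X^k.

Definition vertex_cover_algebra (f : St) : Prop :=
  exists (d : nat) (g : nat -> St),
    (forall k, vca_piece k (g k)) /\ f = \sum_(k < d) g k.

Definition generated_subalg (R : nzRingType) (A : lalgType R)
    (X : A -> Prop) (f : A) : Prop :=
  forall B : {pred A},
    GRing.subalg_closed B -> (forall x, X x -> x \in B) -> f \in B.

Definition standard_graded : Prop :=
  forall f : St, vertex_cover_algebra f <-> generated_subalg (vca_piece 1) f.

End VertexCoverAlgebra.

Section Mengerian.
Variable n : nat.
Local Open Scope ring_scope.

Definition incidence_mx (D : scomplex n) : 'M[nat]_(#|facets D|, n) :=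
  \matrix_(j, i) ((i \in (enum_val j : {set 'I_n})) : nat).

Definition dotv (p : nat) (u v : 'cV[nat]_p) : nat := (u^T *m v) ord0 ord0.

Definition lev (p : nat) (u v : 'cV[nat]_p) : Prop :=
  forall i, (u i ord0 <= v i ord0)%N.

Definition is_min (P : nat -> Prop) (v : nat) : Prop :=
  P v /\ forall w, P w -> (v <= w)%N.

Definition is_max (P : nat -> Prop) (v : nat) : Prop :=
  P v /\ forall w, P w -> (w <= v)%N.

Definition mengerian (D : scomplex n) : Prop :=
  let M := incidence_mx D in
  forall c : 'cV[nat]_n,
    exists v : nat,
      is_min (fun w => exists2 a : 'cV[nat]_n,
                lev (const_mx 1%N) (M *m a) & w = dotv a c) v
      /\
      is_max (fun w => exists2 b : 'cV[nat]_#|facets D|,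
                lev (M^T *m b) c & w = dotv b (const_mx 1%N)) v.

End Mengerian.

(* Main.v *)
Require Import Defs.
From mathcomp Require Import all_boot all_order all_algebra.
From mathcomp Require Import mpoly.

(** Both sides of the equivalence say that every k-cover c of Delta packs k
    vertex covers, i.e. dominates a sum of k indicator vectors of vertex covers
    (predicate [packs]).

    Algebraic side. The algebra A(Delta) and its subalgebra generated in degree
    one are both spanned by monomials, so each is determined by the exponents it
    allows in each degree: x^c t^k lies in A(Delta) iff c is a k-cover
    ([vertex_cover_algebraP]), and in the generated subalgebra iff c packs k
    vertex covers, because the 1-covers are exactly the exponents dominating the
    indicator of a vertex cover ([generatedP]). As packing k vertex covers always
    implies being a k-cover, the two algebras agree iff the converse holds
    ([standard_gradedP]).

    Combinatorial side. The facets of Delta* are the minimal vertex covers of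
    Delta, so a feasible b in the maximum is a multiset of minimal vertex covers
    whose sum is at most c, and the maximum is the largest k such that c packs k
    vertex covers ([dual_packing]). By blocker duality, a set meeting every
    minimal vertex cover contains a facet of Delta ([facet_sub_transversal]), so
    the minimum is attained at the indicator of a facet and equals the least
    c-weight of a facet, i.e. the largest k for which c is a k-cover. Hence the
    two optima agree for every c iff every k-cover packs k vertex covers. *)

Set Implicit Arguments.
Unset Strict Implicit.
Unset Printing Implicit Defensive.

Import GRing.Theory.

(** * Packings of vertex covers *)

Section Packings.
Variables (n : nat) (D : scomplex n).
Implicit Types (k : nat) (c : 'I_n -> nat) (C F A : {set 'I_n}).

(** Boolean form of [kcover], needed because [generated_subalg] quantifies over
    boolean predicates. *)
Definition kcoverb k c : bool :=
  [forall F in facets D, k <= \sum_(i in F) c i].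

Lemma kcoverP k c : reflect (kcover D k c) (kcoverb k c).
Proof. exact: 'forall_implyP. Qed.

(** Tuples, rather than arbitrary sequences, make the existential boolean. *)
Definition packs k c : bool :=
  [exists s : k.-tuple {set 'I_n}, all (vertex_cover D) s &&
     [forall i, \sum_(C <- s) (i \in C) <= c i]].

Lemma packsP k c :
  reflect (exists s : seq {set 'I_n},
             [/\ size s = k, all (vertex_cover D) s &
                 forall i, \sum_(C <- s) (i \in C) <= c i])
          (packs k c).
Proof.
apply: (iffP existsP) => [[s /andP[vs /forallP les]] | [s [sz vs les]]].
  by exists s; rewrite size_tuple.
have szP : size s == k by apply/eqP.
by exists (Tuple szP); rewrite vs; apply/forallP.
Qed.

Lemma packs0 c : packs 0 c.
Proof. by apply/packsP; exists [::]; split=> // i; rewrite big_nil. Qed.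

Lemma packsD j k c d e :
  (forall i, e i = c i + d i) -> packs j c -> packs k d -> packs (j + k) e.
Proof.
move=> eE /packsP[s [<- vs les]] /packsP[t [<- vt ltd]].
apply/packsP; exists (s ++ t); split; rewrite ?size_cat ?all_cat ?vs //.
by move=> i; rewrite big_cat eE leq_add.
Qed.

Lemma packsW j k c : j <= k -> packs k c -> packs j c.
Proof.
move=> lejk /packsP[s [szs vs les]]; apply/packsP; exists (take j s).
split; first by rewrite size_takel ?szs.
  by move: vs; rewrite -{1}(cat_take_drop j s) all_cat => /andP[].
move=> i; apply: leq_trans (les i).
by rewrite -{2}(cat_take_drop j s) big_cat leq_addr.
Qed.

(** Each vertex cover in the packing contributes at least one to the weight of
    any given facet. *)
Lemma packs_kcover k c : packs k c -> kcover D k c.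
Proof.
move=> /packsP[s [<- vs les]] F hF.
apply: (@leq_trans (\sum_(i in F) \sum_(C <- s) (i \in C))); last first.
  by apply: leq_sum => i _; apply: les.
rewrite exchange_big /= -sum1_size !big_seq; apply: leq_sum => C hC.
have := implyP (forallP (allP vs C hC) F) hF => /set0Pn[i /setIP[iC iF]].
by rewrite (bigD1 i) //= iC.
Qed.

(** The support of a 1-cover is a vertex cover. *)
Lemma kcover1_packs c : kcover D 1 c -> packs 1 c.
Proof.
move=> hc; apply/packsP; exists [:: [set i | 0 < c i]]; split=> //=.
  rewrite andbT; apply/'forall_implyP => F hF; apply/set0Pn.
  have := hc F hF; rewrite lt0n sum_nat_eq0 => /forall_inPn[i iF ci].
  by exists i; rewrite !inE iF lt0n ci.
by move=> i; rewrite big_seq1 inE; case: (c i).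
Qed.

(** Otherwise its complement would be a vertex cover, hence would contain a
    minimal vertex cover, which the set would fail to meet. *)
Lemma facet_sub_transversal A :
  (forall C, C \in min_vertex_covers D -> C :&: A != set0) ->
  exists2 F, F \in facets D & F \subset A.
Proof.
move=> hA.
have [/existsP[F /andP[hF sFA]] | noF] :=
  boolP [exists F in facets D, F \subset A]; first by exists F.
have vA : vertex_cover D (~: A).
  apply/'forall_implyP => F hF.
  move: noF; rewrite negb_exists_in => /forall_inP/(_ F hF).
  by rewrite -setD_eq0 setDE setIC.
have [C hC sCA] := minset_exists vA.
have /set0Pn[i /setIP[iC iA]] : C :&: A != set0 by apply: hA; rewrite inE.
by have := subsetP sCA i iC; rewrite inE iA.
Qed.

(** A packing by vertex covers can be replaced by one by minimal vertex covers,
    since shrinking the covers only decreases their sum. *)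
Lemma packs_min k c :
  packs k c ->
  exists s : seq {set 'I_n},
    [/\ size s = k, {subset s <= min_vertex_covers D} &
        forall i, \sum_(C <- s) (i \in C) <= c i].
Proof.
move=> /packsP[s [<- vs les]].
pose f C := odflt set0 [pick C' in min_vertex_covers D | C' \subset C].
have fP C : vertex_cover D C -> f C \in min_vertex_covers D /\ f C \subset C.
  move=> vC; rewrite /f; case: pickP => [C' /andP[] // | none].
  by have [C' hC' sC'] := minset_exists vC; have := none C'; rewrite inE hC' sC'.
exists (map f s); split; first by rewrite size_map.
  by move=> _ /mapP[C hC ->]; case: (fP C (allP vs C hC)).
move=> i; apply: leq_trans (les i); rewrite big_map !big_seq.
apply: leq_sum => C hC; have [_ /subsetP sub] := fP C (allP vs C hC).
by case: (boolP (i \in f C)) => // /sub ->.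
Qed.

End Packings.

(** * Monomial subspaces of S[t] *)

Section MonomialSubspaces.
Variables (K : fieldType) (n : nat).
Local Open Scope ring_scope.
Local Notation S := {mpoly K[n]}.
Local Notation St := {poly {mpoly K[n]}}.
Implicit Types (P : nat -> 'X_{1..n} -> bool) (f g : St) (m : 'X_{1..n}).

(** The K-span of the monomials x^m t^k with P k m. *)
Definition supported P : {pred St} :=
  fun f => [forall k : 'I_(size f), all (P k) (msupp f`_k)].

Lemma supportedP P f :
  reflect (forall k m, m \in msupp f`_k -> P k m) (f \in supported P).
Proof.
apply: (iffP forallP) => [h k m | h k]; last by apply/allP => m; apply: h.
case: (ltnP k (size f)) => [lt_k | le_k].
  exact: (allP (h (Ordinal lt_k))).
by rewrite nth_default // msupp0.
Qed.

Lemma supported0 P : 0 \in supported P.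
Proof. by apply/supportedP => k m; rewrite coef0 msupp0. Qed.

Lemma supportedD P : {in supported P &, forall f g, f + g \in supported P}.
Proof.
move=> f g /supportedP hf /supportedP hg; apply/supportedP => k m.
by rewrite coefD => /msuppD_le; rewrite mem_cat => /orP[/hf | /hg].
Qed.

Lemma supported_monomial P k m (a : K) :
  P k m -> (a *: ('X_[m] : S)) *: 'X^k \in supported P.
Proof.
move=> Pm; apply/supportedP => j m'; rewrite coefZ coefXn.
have [-> | _] := eqVneq j k; last by rewrite mulr0 msupp0.
by rewrite mulr1 => /msuppZ_le; rewrite msuppX inE => /eqP ->.
Qed.

(** The first hypothesis makes the span an S-submodule: every monomial of S has
    t-degree 0. *)
Lemma supported_subalg_closed P :
  (forall m, P 0%N m) ->
  (forall j k m p, P j m -> P k p -> P (j + k)%N (m + p)%MM) ->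
  GRing.subalg_closed (supported P).
Proof.
move=> P0 PD; split.
- apply/supportedP => -[|k] m; first by move=> _; exact: P0.
  by rewrite coef1 msupp0.
- move=> a f g /supportedP hf; apply: supportedD; apply/supportedP => k m.
  rewrite coefZ => /msuppM_le/allpairsP[[m1 m2] /= [_ /hf h2 ->]].
  by rewrite -[k]add0n; apply: PD.
- move=> f g /supportedP hf /supportedP hg; apply/supportedP => k m.
  rewrite coefM => /msupp_sum_le /flatten_mapP[j _].
  move=> /msuppM_le/allpairsP[[m1 m2] /= [/hf h1 /hg h2 ->]].
  by rewrite -(subnKC (ltn_ord j : j <= k)%N); apply: PD.
Qed.

Lemma monomial_expansion f :
  f = \sum_(k < size f)
        \sum_(m <- msupp f`_k) (f`_k@_m *: ('X_[m] : S)) *: 'X^k.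
Proof.
rewrite -{1}[f]coefK poly_def; apply: eq_bigr => k _.
by rewrite -scaler_suml -mpolyE.
Qed.

End MonomialSubspaces.

(** * The vertex cover algebra and its degree-one subalgebra *)

Section Algebra.
Variables (K : fieldType) (n : nat) (D : scomplex n).
Local Open Scope ring_scope.
Local Notation S := {mpoly K[n]}.
Local Notation St := {poly {mpoly K[n]}}.

Lemma vca_piece_supported (P : nat -> 'X_{1..n} -> bool) k (f : St) :
  (forall m : 'X_{1..n}, kcover D k m -> P k m) ->
  vca_piece D k f -> f \in supported P.
Proof.
move=> hP [s hs ->]; rewrite big_seq.
apply: (big_ind (fun g => g \in supported P)) => [||ac /hs /hP]; first exact: supported0.
  by move=> g h hg hh; apply: supportedD.
exact: supported_monomial.
Qed.

Lemma vca_piece_monomial k (m : 'X_{1..n}) (a : K) :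
  kcover D k m -> vca_piece D k ((a *: ('X_[m] : S)) *: 'X^k).
Proof.
move=> hm; exists [:: (a, m)]; last by rewrite big_seq1.
by move=> ac; rewrite inE => /eqP ->.
Qed.

Lemma vertex_cover_algebraP (f : St) :
  vertex_cover_algebra D f <-> f \in supported (fun k m => kcoverb D k m).
Proof.
split=> [[d [g [hg ->]]] | /supportedP hf].
  apply: (big_ind (fun g => g \in supported _)) => [||k _]; first exact: supported0.
    by move=> u v hu hv; apply: supportedD.
  by apply: (vca_piece_supported _ (hg k)) => m hm; apply/kcoverP.
exists (size f), (fun k => \sum_(m <- msupp f`_k) (f`_k@_m *: ('X_[m] : S)) *: 'X^k).
split; last exact: monomial_expansion.
move=> k; exists [seq (f`_k@_m, m) | m <- msupp f`_k]; last by rewrite [RHS]big_map.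
by move=> _ /mapP[m /hf /kcoverP hm ->].
Qed.

Lemma subalg_closed0 (B : {pred St}) : GRing.subalg_closed B -> 0 \in B.
Proof.
by move=> [B1 Blin _]; have := Blin (-1) 1 1 B1 B1; rewrite scaleN1r addNr.
Qed.

Lemma subalg_closedD (B : {pred St}) : GRing.subalg_closed B ->
  forall f g, f \in B -> g \in B -> f + g \in B.
Proof. by move=> [_ Blin _] f g hf hg; rewrite -[f]scale1r; apply: Blin. Qed.

(** If C_1, ..., C_k is a packing in m with remainder r, then x^m t^k is x^r
    times the product of the degree-one monomials x^(C_j) t. *)
Lemma packs_in_subalg (B : {pred St}) k (m : 'X_{1..n}) (a : K) :
  GRing.subalg_closed B -> (forall f, vca_piece D 1 f -> f \in B) ->
  packs D k m -> (a *: ('X_[m] : S)) *: 'X^k \in B.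
Proof.
move=> cB Bpiece /packsP[s [<- vs les]].
have [B1 Blin Bmul] := cB.
have BZ (p : S) u : u \in B -> p *: u \in B.
  by move=> hu; rewrite -[_ *: _]addr0; apply: Blin hu (subalg_closed0 cB).
pose ind (C : {set 'I_n}) : 'X_{1..n} := [multinom (i \in C : nat) | i < n].
have Bprod : forall t : seq {set 'I_n}, all (vertex_cover D) t ->
    ('X_[\sum_(C <- t) ind C] : S) *: 'X^(size t) \in B.
  elim=> [_ | C t IH /= /andP[vC vt]].
    by rewrite big_nil mpolyX0 scale1r expr0; exact: B1.
  have hC : vca_piece D 1 ((1 *: ('X_[ind C] : S)) *: 'X^1 : St).
    apply: vca_piece_monomial; apply: packs_kcover; apply/packsP.
    exists [:: C]; split; rewrite //= ?vC // => i.
    by rewrite big_seq1 mnmE.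
  have := Bmul _ _ (Bpiece _ hC) (IH vt).
  by rewrite scale1r -scalerAl -scalerAr scalerA -mpolyXD -exprD add1n big_cons.
have les' : (\sum_(C <- s) ind C <= m)%MM.
  apply/mnm_lepP => i; rewrite mnm_sumE; apply: leq_trans (les i).
  by under eq_bigr do rewrite mnmE.
rewrite -(submK les') mpolyXD scalerAl -scalerA.
exact: BZ (Bprod s vs).
Qed.

Lemma generatedP (f : St) :
  generated_subalg (vca_piece D 1) f <-> f \in supported (fun k m => packs D k m).
Proof.
split=> [|/supportedP hf B cB hB].
  apply.
    apply: supported_subalg_closed => [m | j k m p]; first exact: packs0.
    by apply: packsD => i; rewrite mnmDE.
  by move=> g; apply: vca_piece_supported => m; apply: kcover1_packs.
have B0 := subalg_closed0 cB; have BD := subalg_closedD cB.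
rewrite (monomial_expansion f); apply: (big_ind (fun g => g \in B)) => [||k _].
- exact: B0.
- exact: BD.
rewrite big_seq; apply: (big_ind (fun g => g \in B)) => [||m /hf].
- exact: B0.
- exact: BD.
exact: packs_in_subalg.
Qed.

Lemma standard_gradedP :
  standard_graded K D <->
  (forall k (m : 'X_{1..n}), kcover D k m -> packs D k m).
Proof.
split=> [std k m hm | h f].
  have : (1 *: ('X_[m] : S)) *: 'X^k \in supported (fun k m => packs D k m).
    apply/generatedP/std/vertex_cover_algebraP.
    by apply: supported_monomial; apply/kcoverP.
  move=> /supportedP/(_ k m); apply.
  by rewrite scale1r coefZ coefXn eqxx mulr1 msuppX inE.
split=> [/vertex_cover_algebraP | /generatedP] /supportedP hf.
  by apply/generatedP/supportedP => k m /hf /kcoverP /h.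
apply/vertex_cover_algebraP/supportedP => k m /hf /packs_kcover.
by move/kcoverP.
Qed.

End Algebra.

(** * The two optima for the dual complex *)

Section Optima.
Variables (n : nat) (D : scomplex n).
Implicit Type c : 'cV[nat]_n.

Local Notation M := (incidence_mx (dual_complex D)).

Lemma facets_dual : facets (dual_complex D) = min_vertex_covers D.
Proof. exact: dual_facetsE. Qed.

Lemma dual_facet_min (j : 'I_#|facets (dual_complex D)|) :
  enum_val j \in min_vertex_covers D.
Proof. by rewrite -facets_dual; apply: enum_valP. Qed.

Lemma dotvE p (u v : 'cV[nat]_p) : dotv u v = \sum_i u i ord0 * v i ord0.
Proof. by rewrite /dotv mxE; apply: eq_bigr => i _; rewrite mxE. Qed.

Lemma incidence_mulE (a : 'cV[nat]_n) j :
  (M *m a)%R j ord0 = \sum_(i in (enum_val j : {set 'I_n})) a i ord0.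
Proof.
rewrite mxE [RHS]big_mkcond; apply: eq_bigr => i _ /=.
by rewrite mxE; case: (i \in _); [exact: mul1n | exact: mul0n].
Qed.

Lemma incidence_trmulE (b : 'cV[nat]_#|facets (dual_complex D)|) i :
  (M^T *m b)%R i ord0 = \sum_j b j ord0 * (i \in (enum_val j : {set 'I_n})).
Proof. by rewrite mxE; apply: eq_bigr => j _; rewrite !mxE; exact: mulnC. Qed.

Lemma facet_feasible c F : F \in facets D ->
  exists2 a : 'cV[nat]_n,
    lev (const_mx 1) (M *m a)%R & \sum_(i in F) c i ord0 = dotv a c.
Proof.
move=> hF; exists (\col_i ((i \in F) : nat))%R.
  move=> j; rewrite incidence_mulE mxE.
  have := dual_facet_min j; rewrite inE => /minsetp /'forall_implyP /(_ F hF).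
  by move=> /set0Pn[i /setIP[iC iF]]; rewrite (bigD1 i) //= mxE iF.
rewrite dotvE big_mkcond; apply: eq_bigr => i _.
by rewrite mxE; case: (i \in F); rewrite ?mul1n ?mul0n.
Qed.

(** The support of a meets every minimal vertex cover, hence contains a facet, on
    which a is at least 1. *)
Lemma feasible_facet c (a : 'cV[nat]_n) : lev (const_mx 1) (M *m a)%R ->
  exists2 F, F \in facets D & \sum_(i in F) c i ord0 <= dotv a c.
Proof.
move=> ha; have [|F hF sF] := @facet_sub_transversal _ D [set i | 0 < a i ord0].
  rewrite -facets_dual => C hC; apply/set0Pn.
  have := ha (enum_rank_in hC C); rewrite incidence_mulE mxE enum_rankK_in //.
  rewrite lt0n sum_nat_eq0 => /forall_inPn[i iC ai].
  by exists i; rewrite !inE iC lt0n ai.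
exists F => //; rewrite dotvE big_mkcond; apply: leq_sum => i _.
by case: ifP => // /(subsetP sF); rewrite inE => ai; rewrite leq_pmull.
Qed.

(** A feasible b is the multiplicity vector of a sequence of minimal vertex
    covers. *)
Lemma dual_packing c k :
  (exists2 b : 'cV[nat]_#|facets (dual_complex D)|,
     lev (M^T *m b)%R c & k = dotv b (const_mx 1)) <->
  packs D k (fun i => c i ord0).
Proof.
split=> [[b hb ->] | /packs_min[s [<- sD les]]].
  apply/packsP.
  exists (flatten [seq nseq (b j ord0) (enum_val j : {set 'I_n}) | j : 'I_#|_|]).
  split.
  - rewrite size_flatten /shape -map_comp sumnE big_map big_enum dotvE.
    by apply: eq_bigr => j _; rewrite /= size_nseq mxE muln1.
  - apply/allP => C /flatten_mapP[j _] /nseqP[-> _].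
    by have := dual_facet_min j; rewrite inE => /minsetp.
  - move=> i; apply: leq_trans (hb i); rewrite incidence_trmulE.
    rewrite big_flatten big_map big_enum /= leq_eqVlt; apply/orP; left.
    by apply/eqP/eq_bigr => j _; rewrite big_nseq iter_addn_0 mulnC.
have regroup (w : {set 'I_n} -> nat) :
    \sum_(C <- s) w C =
    \sum_(j < #|facets (dual_complex D)|)
       count_mem (enum_val j : {set 'I_n}) s * w (enum_val j).
  rewrite -(big_enum_val (fun C => count_mem C s * w C)) /=.
  under [RHS]eq_bigr do rewrite -sum1_count big_distrl /= big_mkcond.
  rewrite exchange_big /=; apply: eq_big_seq => C /sD hC.
  rewrite (bigD1 C) ?facets_dual //= eqxx mul1n big1 ?addn0 // => C' /andP[_].
  by rewrite eq_sym => /negbTE ->.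
exists (\col_j count_mem (enum_val j : {set 'I_n}) s)%R.
  move=> i; rewrite incidence_trmulE; apply: leq_trans (les i).
  rewrite (regroup (fun C => i \in C : nat)).
  by apply: leq_sum => j _; rewrite mxE.
rewrite dotvE -sum1_size (regroup (fun=> 1)).
by apply: eq_bigr => j _; rewrite !mxE.
Qed.

Lemma mengerianP :
  mengerian (dual_complex D) <->
  (forall k (m : 'X_{1..n}), kcover D k m -> packs D k m).
Proof.
split=> [men k m hm | h inc c].
  pose c : 'cV[nat]_n := (\col_i m i)%R.
  have [v [[[a ha va] _] [/dual_packing pv _]]] := men c.
  have [F hF leF] := feasible_facet c ha.
  have le_kv : k <= v.
    rewrite va; apply: leq_trans leF; apply: leq_trans (hm F hF) _.
    by apply: leq_sum => i _; rewrite mxE.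
  have /packsP[s [szs vs les]] := packsW le_kv pv.
  by apply/packsP; exists s; split=> // i; have := les i; rewrite mxE.
have /set0Pn[F0 hF0] := has_facet D.
pose wt (F : {set 'I_n}) := \sum_(i in F) c i ord0.
have [F hF minF] := arg_minnP (P := mem (facets D)) wt hF0.
exists (wt F); split; split.
- exact: facet_feasible.
- move=> w [a ha ->]; have [G hG leG] := feasible_facet c ha.
  exact: leq_trans (minF G hG) leG.
- apply/dual_packing.
  have /h /packsP[s [szs vs les]] :
      kcover D (wt F) [multinom c i ord0 | i < n].
    move=> G hG; apply: leq_trans (minF G hG) _.
    by apply: leq_sum => i _; rewrite mnmE.
  by apply/packsP; exists s; split=> // i; have := les i; rewrite mnmE.
- by move=> w /dual_packing /packs_kcover; apply.
Qed.

End Optima.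

Theorem theorem1p4 (K : fieldType) (n : nat) (Delta : scomplex n) :
  standard_graded K Delta <-> mengerian (dual_complex Delta).
Proof. by rewrite standard_gradedP mengerianP. Qed.
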